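(* Let $S$ be a semigroup with $0$ (not necessarily commutative). If the undirected graph $\overline{\Gamma}(S)$ contains a cycle, then $\mathrm{gr}(\overline{\Gamma}(S))\le 4$.
   Context: $D(S)$ is the set of one-sided zero-divisors of $S$, and $D(S)^{*}=D(S)\setminus\{0\}$; thus a nonzero $a\in S$ lies in $D(S)^*$ iff there is a nonzero $b\in S$ with $ab=0$ or $ba=0$. $\overline{\Gamma}(S)$ is the undirected graph with vertex set $D(S)^{*}$ in which two distinct vertices $a,b$ are adjacent iff $ab=0$ or $ba=0$. $\mathrm{gr}$ denotes the girth, i.e. the length of a shortest cycle ($\infty$ if there is no cycle). *)

(* Defs.v *)
From mathcomp Require Import all_boot all_order all_algebra.
From mathcomp Require Import all_classical.
From mathcomp Require Import constructive_ereal.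

Set Implicit Arguments.
Unset Strict Implicit.
Unset Printing Implicit Defensive.

Local Open Scope classical_set_scope.
Local Open Scope ring_scope.

Section Graph.
Context {V : choiceType}.
Implicit Types (adj : rel V) (c : seq V).

(* [ucycle adj c] also holds for the empty sequence, for a single loop vertex
   and for a single edge, whence the length condition. *)
Definition graph_cycle adj c : Prop := ucycle adj c /\ (3 <= size c)%N.

Definition has_cycle_length adj : pred nat :=
  fun n => `[< exists2 c, graph_cycle adj c & size c = n >].

Definition girth adj : \bar int :=
  if pselect (exists n, has_cycle_length adj n) is left cyc
  then ((ex_minn cyc)%:Z)%:E else +oo%E.

End Graph.

Section ZeroDivisorGraph.
Variables (S : semigroupType) (zero : S).

Definition zero_divisors : set S :=
  [set a | exists2 b : S, b != zero & (a * b)%g = zero \/ (b * a)%g = zero].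

Definition nonzero_zero_divisors : set S := zero_divisors `\ zero.

(* The vertices of the graph: the subtype of nonzero one-sided zero-divisors. *)
Definition zd_vertex : choiceType := set_type nonzero_zero_divisors.

Definition zd_adj : rel zd_vertex := fun a b =>
  (a != b) && (((val a * val b)%g == zero) || ((val b * val a)%g == zero)).

End ZeroDivisorGraph.

Arguments zd_adj {S} zero a b.

(* Main.v *)
Require Import Defs.
From mathcomp Require Import all_boot all_order all_algebra.
From mathcomp Require Import all_classical.
From mathcomp Require Import constructive_ereal.

Local Open Scope ring_scope.

(** Suppose that the graph has neither triangles nor 4-cycles, and let
    z - a - b - c - d - e be consecutive vertices of a cycle, where z = e is
    possible. The idea is to exhibit products of vertices that annihilate two
    adjacent vertices, or two neighbours of one vertex: such a product must be
    zero or one of the vertices at hand, since otherwise it would close a short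
    cycle.

    This is first used to recover commutativity where it matters: the middle
    edge b - c of a path a - b - c - d satisfies both bc = 0 and cb = 0
    ([mid_edge_two_sided]). Hence the edges a - b, b - c and c - d of the long
    path are two-sided, and both ad and da annihilate b and c, so that each of
    them is b or c (if one of them were 0, the path would close up into a
    4-cycle). If de = 0, then (ad)e = 0 makes b or c a neighbour of e,
    which closes b - c - d - e or c - d - e; if ed = 0, the same happens with
    da ([no_long_path]). A cycle of length at least 5 contains such a path. *)

(** * The annihilation graph *)

Section Annihilation.
Context (S : semigroupType) (zero : S).

(** The graph is carried by all of [S], with [zero] and the regular elements
    isolated, so that a product can be tested for adjacency before it is known
    to be a zero-divisor. *)
Definition ann_adj : rel S := fun x y =>
  [&& x != zero, y != zero, x != y & ((x * y)%g == zero) || ((y * x)%g == zero)].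

Definition triangle_free : Prop :=
  forall x y z, ann_adj x y -> ann_adj y z -> ann_adj z x -> False.

Definition square_free : Prop :=
  forall x y z t, x != z -> y != t ->
    ann_adj x y -> ann_adj y z -> ann_adj z t -> ann_adj t x -> False.

Lemma ann_adj_sym x y : ann_adj x y = ann_adj y x.
Proof. by rewrite /ann_adj andbCA [x == y]eq_sym orbC. Qed.

Lemma ann_adj_mul0 {x y} :
  ann_adj x y -> (x * y)%g = zero \/ (y * x)%g = zero.
Proof. by case/and4P=> _ _ _ /orP[]/eqP ->; [left | right]. Qed.

Lemma ann_adjI x y : x <> zero -> y <> zero -> x <> y ->
  (x * y)%g = zero \/ (y * x)%g = zero -> ann_adj x y.
Proof.
move=> /eqP x0 /eqP y0 /eqP xy h; rewrite /ann_adj x0 y0 xy /=.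
by case: h => ->; rewrite eqxx ?orbT.
Qed.

Lemma ann_adj_neq0 {x y} : ann_adj x y -> x <> zero.
Proof. by case/and4P=> /eqP. Qed.

(** * Paths in the absence of triangles and 4-cycles *)

Section LargeGirth.
Context (zero_mul : left_zero zero *%g) (mul_zero : right_zero zero *%g).
Context (no3 : triangle_free) (no4 : square_free).

Lemma ann_ends_mul_neq0 {x y z} : ann_adj x y -> ann_adj y z -> x != z ->
  (x * z)%g = zero \/ (z * x)%g = zero -> False.
Proof.
move=> xy yz /eqP xz h; apply: (no3 x y z) => //; rewrite ann_adj_sym.
apply: ann_adjI => //; first exact: ann_adj_neq0 xy.
by rewrite ann_adj_sym in yz; exact: ann_adj_neq0 yz.
Qed.

Lemma ann_edge {x y} t : ann_adj x y ->
  (x * t)%g = zero \/ (t * x)%g = zero ->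
  (y * t)%g = zero \/ (t * y)%g = zero -> [\/ t = zero, t = x | t = y].
Proof.
move=> xy xt yt.
case: (eqVneq t zero) => [|/eqP t0]; first by constructor.
case: (eqVneq t x) => [|/eqP tx]; first by constructor.
case: (eqVneq t y) => [|/eqP ty]; first by constructor.
case: (no3 x y t) => //.
- apply: ann_adjI => //; last exact: nesym.
  by rewrite ann_adj_sym in xy; exact: ann_adj_neq0 xy.
- by rewrite ann_adj_sym; apply: ann_adjI => //;
    [exact: ann_adj_neq0 xy | exact: nesym].
Qed.

Lemma ann_path2 {x y z} t : ann_adj x y -> ann_adj y z -> x != z ->
  (x * t)%g = zero \/ (t * x)%g = zero ->
  (z * t)%g = zero \/ (t * z)%g = zero ->
  [\/ t = zero, t = x, t = y | t = z].
Proof.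
move=> xy yz xz xt zt.
case: (eqVneq t zero) => [|/eqP t0]; first by constructor.
case: (eqVneq t x) => [|/eqP tx]; first by constructor.
case: (eqVneq t y) => [|ty]; first by constructor.
case: (eqVneq t z) => [|/eqP tz]; first by constructor.
case: (no4 x y z t) => //; first by rewrite eq_sym.
- apply: ann_adjI => //; last exact: nesym.
  by rewrite ann_adj_sym in yz; exact: ann_adj_neq0 yz.
- by rewrite ann_adj_sym; apply: ann_adjI => //;
    [exact: ann_adj_neq0 xy | exact: nesym].
Qed.

Lemma ann_path3_neq0 {x y z t} : ann_adj x y -> ann_adj y z -> ann_adj z t ->
  x != z -> y != t -> (x * t)%g = zero \/ (t * x)%g = zero -> False.
Proof.
move=> xy yz zt xz yt h.
have t0 : t <> zero by rewrite ann_adj_sym in zt; exact: ann_adj_neq0 zt.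
case: (eqVneq x t) => [xt|/eqP xt].
  by subst t; apply: (no3 x y z).
apply: (no4 x y z t) => //; rewrite ann_adj_sym.
by apply: ann_adjI => //; exact: ann_adj_neq0 xy.
Qed.

(** Orient an edge from x to y when xy = 0. Each of the four ways to orient the
    outer edges has its own product: da when they point forward, cb when they
    point backward, ca when they point inward and db when they point outward. In
    each case the product annihilates so many vertices of the path that its
    possible values all either give cb = 0 or close a short cycle. *)
Lemma mid_edge_reverse {a b c d} :
  ann_adj a b -> ann_adj b c -> ann_adj c d -> a != c -> b != d ->
  (b * c)%g = zero -> (c * b)%g = zero.
Proof.
move=> ab bc cd ac bd bc0.
have ac_neq := ann_ends_mul_neq0 ab bc ac.
have bd_neq := ann_ends_mul_neq0 bc cd bd.
have ad_neq := ann_path3_neq0 ab bc cd ac bd.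
have [ab0|ba0] := ann_adj_mul0 ab; have [cd0|dc0] := ann_adj_mul0 cd.
- have dab0 : (d * a * b)%g = zero by rewrite -mulgA ab0 mul_zero.
  have cda0 : (c * (d * a))%g = zero by rewrite mulgA cd0 zero_mul.
  case: (ann_edge (d * a)%g bc); [by right | by left | | |] => E.
  + by case: ad_neq; right.
  + by rewrite -E.
  + by rewrite -E.
- have cab0 : (c * a * b)%g = zero by rewrite -mulgA ab0 mul_zero.
  have dca0 : (d * (c * a))%g = zero by rewrite mulgA dc0 zero_mul.
  case: (ann_path2 (c * a)%g bc cd bd); [by right | by left | | | |] => E.
  + by case: ac_neq; right.
  + by case: bd_neq; right; rewrite -E.
  + by rewrite -[X in (X * b)%g]E.
  + by case: bd_neq; right; rewrite -[X in (X * b)%g]E.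
- have cdb0 : (c * (d * b))%g = zero by rewrite mulgA cd0 zero_mul.
  have dba0 : (d * b * a)%g = zero by rewrite -mulgA ba0 mul_zero.
  case: (ann_path2 (d * b)%g ab bc ac); [by right | by left | | | |] => E.
  + by case: bd_neq; right.
  + by case: ac_neq; left; rewrite -E -mulgA bc0 mul_zero.
  + by rewrite -[X in (c * X)%g]E.
  + by case: ac_neq; right; rewrite -E.
- have cba0 : (c * b * a)%g = zero by rewrite -mulgA ba0 mul_zero.
  have bcb0 : (b * (c * b))%g = zero by rewrite mulgA bc0 zero_mul.
  have cbc0 : (c * b * c)%g = zero by rewrite -mulgA bc0 mul_zero.
  have dcb0 : (d * (c * b))%g = zero by rewrite mulgA dc0 zero_mul.
  (* a nonzero cb would lie in both {a, b} and {c, d} *)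
  case: (ann_edge (c * b)%g ab); [by right | by left | by [] | |] => E.
  + case: (ann_edge (c * b)%g cd); [by right | by left | by [] | |] => E'.
    * by move: ac; rewrite -E E' eqxx.
    * by case: (no3 a b c) => //; rewrite -E E'.
  + case: (ann_edge (c * b)%g cd); [by right | by left | by [] | |] => E'.
    * by case/and4P: bc => _ _; rewrite -E E' eqxx.
    * by move: bd; rewrite -E E' eqxx.
Qed.

Lemma mid_edge_two_sided {a b c d} :
  ann_adj a b -> ann_adj b c -> ann_adj c d -> a != c -> b != d ->
  (b * c)%g = zero /\ (c * b)%g = zero.
Proof.
move=> ab bc cd ac bd; have [bc0|cb0] := ann_adj_mul0 bc.
  by split=> //; apply: (mid_edge_reverse ab bc cd).
split=> //; rewrite ann_adj_sym in ab; rewrite ann_adj_sym in bc.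
rewrite ann_adj_sym in cd.
by apply: (mid_edge_reverse cd bc ab) => //; rewrite eq_sym.
Qed.

(** The initial edge z - a serves only to make a - b the middle edge of a path,
    hence two-sided. *)
Lemma no_long_path {z a b c d e} :
  ann_adj z a -> ann_adj a b -> ann_adj b c -> ann_adj c d -> ann_adj d e ->
  z != b -> a != c -> b != d -> c != e -> False.
Proof.
move=> za ab bc cd de zb ac bd ce.
have [ab0 ba0] := mid_edge_two_sided za ab bc zb ac.
have [cd0 dc0] := mid_edge_two_sided bc cd de bd ce.
have ad_neq := ann_path3_neq0 ab bc cd ac bd.
have be_neq := ann_path3_neq0 bc cd de bd ce.
have ce_neq := ann_ends_mul_neq0 cd de ce.
have [de0|ed0] := ann_adj_mul0 de.
- have ade0 : (a * d * e)%g = zero by rewrite -mulgA de0 mul_zero.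
  case: (ann_edge (a * d)%g bc) => [|||E|E].
  + by left; rewrite mulgA ba0 zero_mul.
  + by right; rewrite -mulgA dc0 mul_zero.
  + by move=> E; apply: ad_neq; left.
  + by apply: be_neq; left; rewrite -E.
  + by apply: ce_neq; left; rewrite -E.
- have eda0 : (e * (d * a))%g = zero by rewrite mulgA ed0 zero_mul.
  case: (ann_edge (d * a)%g bc) => [|||E|E].
  + by right; rewrite -mulgA ab0 mul_zero.
  + by left; rewrite mulgA cd0 zero_mul.
  + by move=> E; apply: ad_neq; right.
  + by apply: be_neq; right; rewrite -E.
  + by apply: ce_neq; right; rewrite -E.
Qed.

Lemma long_girth_acyclic s : ucycle ann_adj s -> (3 <= size s)%N -> False.
Proof.
case: s => [|a [|b [|c [|d [|e s]]]]] //= /andP[].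
- by move=> /and4P[ab bc ca _] _ _; apply: (no3 a b c).
- move=> /and5P[ab bc cd da _] /=; rewrite !inE !negb_or.
  by move=> /and4P[/and3P[_ ac _] /andP[_ bd] _ _] _; apply: (no4 a b c d).
move=> /and5P[ab bc cd de]; rewrite -/(path ann_adj e (rcons s a)).
rewrite rcons_path => /andP[_ za] Us _.
(* the predecessor of a around the cycle is e itself when the length is 5 *)
have zes := mem_last e s.
move: (last e s) za zes => z za zes.
case/and5P: Us; rewrite 2![in X in X -> _]inE 2!negb_or => /and3P[_ ac _].
rewrite 2![in X in X -> _]inE 2!negb_or => /and3P[_ bd bes].
rewrite 2![in X in X -> _]inE 2!negb_or => /and3P[_ ce _] _ _.
apply: (no_long_path za ab bc cd de) => //.
by apply: contra bes => /eqP <-.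
Qed.

End LargeGirth.

(** * Cycles of zero-divisors *)

(** Being a nonzero zero-divisor is implied by having a neighbour, so cycles of
    the two graphs correspond to each other although their vertex types differ. *)
Lemma zd_adjE (x y : zd_vertex zero) : zd_adj zero x y = ann_adj (val x) (val y).
Proof.
have nz (v : zd_vertex zero) : val v != zero.
  by apply/eqP; have := set_valP v; case.
by rewrite /ann_adj !nz /= /zd_adj (inj_eq val_inj).
Qed.

Lemma ann_adj_vertex {x y} : ann_adj x y -> exists v : zd_vertex zero, val v = x.
Proof.
move=> /and4P[x0 y0 _ /orP xy].
have xV : nonzero_zero_divisors zero x.
  split; last exact/eqP.
  by exists y => //; case: xy => /eqP; [left | right].
by exists (exist _ x (mem_set xV)).
Qed.

Lemma zd_triangle x y z : ann_adj x y -> ann_adj y z -> ann_adj z x ->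
  exists2 c, graph_cycle (zd_adj zero) c & size c = 3.
Proof.
move=> xy yz zx.
have [u ux] := ann_adj_vertex xy; have [v vy] := ann_adj_vertex yz.
have [w wz] := ann_adj_vertex zx; subst x y z.
exists [:: u; v; w] => //; split=> //; rewrite /ucycle /= !zd_adjE xy yz zx /=.
by move: xy yz zx => /and4P[_ _ uv _] /and4P[_ _ vw _] /and4P[_ _ wu _];
  rewrite !inE -!(inj_eq val_inj) (negPf uv) (negPf vw) eq_sym (negPf wu).
Qed.

Lemma zd_square x y z t : x != z -> y != t ->
  ann_adj x y -> ann_adj y z -> ann_adj z t -> ann_adj t x ->
  exists2 c, graph_cycle (zd_adj zero) c & size c = 4.
Proof.
move=> xz yt xy yz zt tx.
have [u ux] := ann_adj_vertex xy; have [v vy] := ann_adj_vertex yz.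
have [w wz] := ann_adj_vertex zt; have [r rt] := ann_adj_vertex tx.
subst x y z t.
exists [:: u; v; w; r] => //; split=> //.
rewrite /ucycle /= !zd_adjE xy yz zt tx /=.
by move: xy yz zt tx => /and4P[_ _ uv _] /and4P[_ _ vw _] /and4P[_ _ wr _]
  /and4P[_ _ ru _]; rewrite !inE -!(inj_eq val_inj) (negPf uv) (negPf vw)
  (negPf wr) (negPf xz) (negPf yt) eq_sym (negPf ru).
Qed.

End Annihilation.

Lemma girth_le_size (V : choiceType) (adj : rel V) c :
  graph_cycle adj c -> (girth adj <= (size c)%:Z%:E)%E.
Proof.
move=> cyc; have cP : has_cycle_length adj (size c) by apply/asboolP; exists c.
rewrite /girth; case: pselect => [ex|[]]; last by exists (size c).
by case: ex_minnP => m _ /(_ _ cP); rewrite lee_fin.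
Qed.

Theorem theorem3p2 (S : semigroupType) (zero : S)
    (zero_mul : left_zero zero *%g) (mul_zero : right_zero zero *%g)
    (has_cycle : exists c : seq (zd_vertex zero), graph_cycle (zd_adj zero) c) :
  (girth (zd_adj zero) <= (4%:Z)%:E)%E.
Proof.
have [//|no_short] := pselect (girth (zd_adj zero) <= (4%:Z)%:E)%E.
have no_short_cycle c : graph_cycle (zd_adj zero) c -> (size c <= 4)%N -> False.
  move=> cyc c4; apply: no_short; apply: Order.POrderTheory.le_trans (girth_le_size _ _ _ cyc) _.
  by rewrite lee_fin.
have no3 : triangle_free S zero.
  move=> x y z xy yz zx; have [c cyc c3] := zd_triangle _ _ _ _ _ xy yz zx.
  by apply: no_short_cycle cyc _; rewrite c3.
have no4 : square_free S zero.
  move=> x y z t xz yt xy yz zt tx.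
  have [c cyc c4] := zd_square _ _ _ _ _ _ xz yt xy yz zt tx.
  by apply: no_short_cycle cyc _; rewrite c4.
have [c [/andP[cc Uc] c3]] := has_cycle.
case: (long_girth_acyclic _ _ zero_mul mul_zero no3 no4 (map val c)).
  rewrite /ucycle cycle_map (map_inj_uniq val_inj) Uc andbT.
  by rewrite -(eq_cycle (zd_adjE _ _)).
by rewrite size_map.
Qed.
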